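(* Let $f,g:\mathbb{R}^n\to\mathbb{R}\cup\{+\infty\}$ be closed convex proper functions such that there exist $x^\star,u^\star\in\mathbb{R}^n$ with $0\in\partial f(x^\star)+u^\star$ and $0\in\partial g^*(u^\star)-x^\star$. Let $\alpha>0$, let $x^0,u^0\in\mathbb{R}^n$, and let $\{(x^k,u^k)\}_{k\ge 0}$ be generated by $$x^{k+1}=\mathrm{prox}_{\alpha f}\big(x^k-\alpha u^k\big),\qquad u^{k+1}=\mathrm{prox}_{\alpha^{-1}g^*}\big(u^k+\tfrac1\alpha(2x^{k+1}-x^k)\big),\qquad k=0,1,2,\dots$$ For $k\ge1$ let $p^k=x^k+(x^k-x^{k-1})+\alpha(u^{k-1}-u^k)\in\partial g^*(u^k)$, let $\widetilde\nabla f(x^k)=\frac1\alpha\big(x^{k-1}-\alpha u^{k-1}-x^k\big)\in\partial f(x^k)$, and $v^k=\widetilde\nabla f(x^k)+u^k$. Let $K\ge1$ be an integer, $\bar x^K=\frac1K\sum_{k=1}^K x^k$, $\bar u^K=\frac1K\sum_{k=1}^K u^k$. Then for all $x,u\in\mathbb{R}^n$ and all subgradients $\bar p^K\in\partial g^*(\bar u^K)$, $p\in\partial g^*(u)$, $\widetilde\nabla f(\bar x^K)\in\partial f(\bar x^K)$, $$\mathcal{L}(\bar x^K,u)-\mathcal{L}(x,\bar u^K)-\frac{1}{\alpha(K+1)}\left(\|x^0-x\|^2+\alpha^2\|u^0-u\|^2\right)=I_f+I_g-\mathcal{S}_1-\mathcal{S}_2,$$ where $$I_f=\tfrac1K\sum_{k=1}^K\big(f(\bar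 x^K)-f(x^k)+\langle\widetilde\nabla f(\bar x^K),x^k-\bar x^K\rangle\big)+\tfrac1K\sum_{k=1}^K\big(f(x^k)-f(x)+\langle\widetilde\nabla f(x^k),x-x^k\rangle\big),$$ $$I_g=\tfrac1K\sum_{k=1}^K\big(g(p^k)-g(\bar p^K)+\langle u^k,\bar p^K-p^k\rangle\big)+\tfrac1K\sum_{k=1}^K\big(g(p)-g(p^k)+\langle u,p^k-p\rangle\big),$$ $$\mathcal{S}_1=\tfrac{1}{\alpha(K+1)}\Big(\Big\|x^0-x-\tfrac{\alpha(K+1)}{2K}\sum_{k=1}^K v^k\Big\|^2+\alpha^2\Big\|u^0-u+\tfrac{K+1}{2K}\sum_{k=1}^K v^k\Big\|^2\Big),$$ $$\mathcal{S}_2=\tfrac{\alpha}{2K^2}\sum_{k=1}^K\sum_{l=1}^{k-1}\|v^k-v^l\|^2.$$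
   Context: $\langle\cdot,\cdot\rangle$ and $\|\cdot\|$ are the standard inner product and Euclidean norm on $\mathbb{R}^n$. $g^*(y)=\sup_x\{\langle y,x\rangle-g(x)\}$ is the Fenchel conjugate, $\partial$ the convex subdifferential, and $\mathrm{prox}_\varphi(x)=\arg\min_{y}\{\varphi(y)+\frac12\|y-x\|^2\}$. The Lagrangian is $\mathcal{L}(x,u)=f(x)+\langle u,x\rangle-g^*(u)$, with $\mathcal{L}(x,u)=+\infty$ if $x\notin\mathrm{dom}\, f$ and $\mathcal{L}(x,u)=-\infty$ if $x\in\mathrm{dom}\, f$, $u\notin\mathrm{dom}\, g^*$; if $x\notin\mathrm{dom}\, f$ both sides of the equality are read as $-\infty$. The iteration is the swapped Douglas--Rachford splitting algorithm (variant DRS-$fg$) for minimizing $f+g$. *)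

(* Defs.v *)
From HB Require Import structures.
From mathcomp Require Export all_boot all_order all_algebra.
From mathcomp Require Export all_classical all_reals all_analysis.
Export numFieldNormedType.Exports.

Set Implicit Arguments.
Unset Strict Implicit.
Unset Printing Implicit Defensive.

Import Order.TTheory GRing.Theory Num.Theory.

Local Open Scope classical_set_scope.
Local Open Scope ring_scope.

(* The library norm `|x| on matrices is the sup norm, hence dotv and enorm. *)
Definition dotv {R : realType} {n : nat} (x y : 'rV[R]_n) : R :=
  \sum_(i < n) x ord0 i * y ord0 i.

Definition enorm {R : realType} {n : nat} (x : 'rV[R]_n) : R :=
  Num.sqrt (dotv x x).

Definition dom {R : realType} {n : nat} (f : 'rV[R]_n -> \bar R) :
    set 'rV[R]_n :=
  [set x | (f x < +oo)%E].

Definition epigraph {R : realType} {n : nat} (f : 'rV[R]_n -> \bar R) :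
    set ('rV[R]_n * R) :=
  [set z | (f z.1 <= z.2%:E)%E].

(* R u {+oo}-valued and not identically +oo *)
Definition proper_fun {R : realType} {n : nat} (f : 'rV[R]_n -> \bar R) : Prop :=
  (forall x, f x != -oo%E) /\ dom f !=set0.

Definition closed_fun {R : realType} {n : nat} (f : 'rV[R]_n -> \bar R) : Prop :=
  closed (epigraph f).

(* Only used on functions avoiding -oo, so the right-hand side never is the
   indeterminate form +oo - oo; moreover 0 * +oo = 0 in \bar R, so that the
   endpoints t = 0, 1 are harmless. *)
Definition convex_fun {R : realType} {n : nat} (f : 'rV[R]_n -> \bar R) : Prop :=
  forall (x y : 'rV[R]_n) (t : R), 0 <= t <= 1 ->
    (f (t *: x + (1 - t) *: y)%R <= t%:E * f x + (1 - t)%:E * f y)%E.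

Definition fenchel {R : realType} {n : nat} (g : 'rV[R]_n -> \bar R)
    (y : 'rV[R]_n) : \bar R :=
  ereal_sup [set ((dotv y x)%:E - g x)%E | x in [set: 'rV[R]_n]].

Definition subdiff {R : realType} {n : nat} (phi : 'rV[R]_n -> \bar R)
    (x : 'rV[R]_n) : set 'rV[R]_n :=
  [set s | forall y, (phi x + (dotv s (y - x))%:E <= phi y)%E].

Definition argmin {R : realType} {n : nat} (F : 'rV[R]_n -> \bar R) :
    set 'rV[R]_n :=
  [set y | forall z, (F y <= F z)%E].

(* The proximal operator as the set of minimizers, which is a singleton when
   phi is closed, convex and proper. *)
Definition prox {R : realType} {n : nat} (phi : 'rV[R]_n -> \bar R)
    (x : 'rV[R]_n) : set 'rV[R]_n :=
  argmin (fun y => (phi y + (2^-1 * enorm (y - x) ^+ 2)%:E)%E).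

Definition lagrangian {R : realType} {n : nat} (f g : 'rV[R]_n -> \bar R)
    (x u : 'rV[R]_n) : \bar R :=
  if x \notin dom f then +oo%E
  else if u \notin dom (fenchel g) then -oo%E
  else (f x + (dotv u x)%:E - fenchel g u)%E.

(* Main.v *)
Require Import Defs.
From mathcomp Require Import ring lra.

Set Implicit Arguments.
Unset Strict Implicit.
Unset Printing Implicit Defensive.

Import Order.TTheory GRing.Theory Num.Theory.

Local Open Scope classical_set_scope.
Local Open Scope ring_scope.

(** The identity becomes algebra once every value of [f] and [g] in it is known
    to be finite and every value [g p] is traded for a value of the conjugate.

    Convex side.  The first-order condition for a proximal step
    ([prox_subdiff]) puts [gradfs k] in the subdifferential of [f] at [xs k] and
    [ps k] in that of [fenchel g] at [us k]; for the latter the conjugate has to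
    be proper and convex.  Fenchel equality [g p = <u, p> - fenchel g u] for
    [p] in the subdifferential of the conjugate at [u] is the only trace of the
    biconjugation theorem that is required.  Both this equality and the
    properness of the conjugate come from the projection of a point of
    R^n x R onto the epigraph of [g] ([epigraph_projection]): its variational
    inequality is an affine minorant of [g] whenever the projection moves the
    point upwards.

    Algebraic side.  With [z k := xs k - alpha *: us k] the two steps of the
    iteration say exactly
<<
      alpha *: vs k = z k.-1 - z k,     ps k = xs k - alpha *: vs k.
>>
    What remains of the summands is [<vs k, z k - (x - alpha *: u)>].  Since
    [z k - z 0] is [- alpha] times the sum of [vs 1], ..., [vs k], the part
    [<vs k, z k - z 0>] adds up to a symmetric quadratic form in the [vs k],
    that is, a combination of the square of their sum and of their pairwise
    distances.  The distances are [S2]; the square of the sum completes the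
    linear part [<vs k, z 0 - (x - alpha *: u)>] to the squares in [S1]
    ([averaged_gap]).

    If [x] lies outside the domain of [f], the second sum of [I_f] and the
    left-hand side are both [-oo], all the other terms being finite. *)

(** * The Euclidean inner product *)

Section InnerProduct.
Context {R : realType} {n : nat}.
Implicit Types (x y z : 'rV[R]_n) (a : R).

Lemma dotvC x y : dotv x y = dotv y x.
Proof. by apply: eq_bigr => i _; rewrite mulrC. Qed.

Lemma dotvDl x y z : dotv (x + y) z = dotv x z + dotv y z.
Proof. by rewrite -big_split; apply: eq_bigr => i _; rewrite mxE mulrDl. Qed.

Lemma dotvZl a x y : dotv (a *: x) y = a * dotv x y.
Proof. by rewrite mulr_sumr; apply: eq_bigr => i _; rewrite mxE mulrA. Qed.

Lemma dotvNl x y : dotv (- x) y = - dotv x y.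
Proof. by rewrite -scaleN1r dotvZl mulN1r. Qed.

Lemma dot0v x : dotv 0 x = 0.
Proof. by rewrite -(scale0r 0) dotvZl mul0r. Qed.

Lemma dotvDr x y z : dotv z (x + y) = dotv z x + dotv z y.
Proof. by rewrite dotvC dotvDl !(dotvC z). Qed.

Lemma dotvZr a x y : dotv y (a *: x) = a * dotv y x.
Proof. by rewrite dotvC dotvZl dotvC. Qed.

Lemma dotvNr x y : dotv y (- x) = - dotv y x.
Proof. by rewrite dotvC dotvNl dotvC. Qed.

Lemma dotv0 x : dotv x 0 = 0.
Proof. by rewrite dotvC dot0v. Qed.

Definition dotvE := (dotvDl, dotvDr, dotvZl, dotvZr, dotvNl, dotvNr).

Lemma dotv_suml (I : Type) (s : seq I) (F : I -> 'rV[R]_n) x :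
  dotv (\sum_(i <- s) F i) x = \sum_(i <- s) dotv (F i) x.
Proof.
exact: (big_morph (fun y => dotv y x) (fun y z => dotvDl y z x) (dot0v x)).
Qed.

Lemma dotv_sumr (I : Type) (s : seq I) (F : I -> 'rV[R]_n) x :
  dotv x (\sum_(i <- s) F i) = \sum_(i <- s) dotv x (F i).
Proof. by rewrite dotvC dotv_suml; apply: eq_bigr => i _; rewrite dotvC. Qed.

Lemma dotv_ge0 x : 0 <= dotv x x.
Proof. by apply: sumr_ge0 => i _; rewrite -expr2 sqr_ge0. Qed.

Lemma coord_le_dotv x i : x ord0 i ^+ 2 <= dotv x x.
Proof.
rewrite /dotv (bigD1 i) //= -expr2 lerDl.
by apply: sumr_ge0 => j _; rewrite -expr2 sqr_ge0.
Qed.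

Lemma dotv_eq0 x : dotv x x <= 0 -> x = 0.
Proof.
move=> x0; apply/rowP => i; rewrite mxE; apply/eqP.
by rewrite -sqrf_eq0 eq_le sqr_ge0 andbT (le_trans (coord_le_dotv x i)).
Qed.

Lemma enorm_sqr x : enorm x ^+ 2 = dotv x x.
Proof. by rewrite sqr_sqrtr ?dotv_ge0. Qed.

Lemma dotv_continuous : continuous (fun x : 'rV[R]_n => dotv x x).
Proof.
apply: continuous_big => [|i _ x]; first exact: add_continuous.
by apply: continuousM; apply: (@coord_continuous R 1 n ord0 i).
Qed.

End InnerProduct.

(** * Projection onto a closed convex epigraph *)

(** The first-order consequence of minimality along a segment: divide by [t]
    and let it tend to 0. *)
Lemma slope_ge0 {R : realType} (a b : R) :
  (forall t, 0 < t <= 1 -> 0 <= t * a + t ^+ 2 * b) -> 0 <= a.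
Proof.
move=> h; rewrite leNgt; apply/negP => a0.
pose m := `|b| + 1 - a.
have m0 : 0 < m by have := normr_ge0 b; rewrite /m; lra.
(* At this [t] the quadratic term is too small to compensate [a]. *)
have am : 0 < - a / m <= 1.
  rewrite divr_gt0 ?oppr_gt0 //= ler_pdivrMr // /m.
  by have := normr_ge0 b; lra.
have := h _ am; case/andP: am => t0 _.
set t := - a / m in t0 *.
have -> : t * a + t ^+ 2 * b = t * (a + t * b) by ring.
rewrite pmulr_rge0 // => h2.
have tm : t * m = - a by rewrite /t divfK // gt_eqF.
have : t * b <= t * `|b| by rewrite ler_pM2l // ler_norm.
move: tm h2; rewrite /m => tm h2 h3.
have : 0 < t * (1 - a) by rewrite mulr_gt0 //; lra.
by nra.
Qed.

Section Epigraph.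
Context {R : realType} {n : nat}.
Implicit Types (f g : 'rV[R]_n -> \bar R) (x y z p : 'rV[R]_n).

(** The squared distance to [(p, r0)] is continuous and its sublevel sets are
    bounded, so that its minimum over the closed epigraph can be sought in a
    compact box. *)
Lemma epigraph_nearest f p (r0 : R) : closed_fun f -> dom f !=set0 ->
  exists z r, (f z <= r%:E)%E /\ forall y s, (f y <= s%:E)%E ->
    dotv (z - p) (z - p) + (r - r0) ^+ 2
      <= dotv (y - p) (y - p) + (s - r0) ^+ 2.
Proof.
move=> fc [x0 x0f].
have [s0 fs0] : exists s0 : R, (f x0 <= s0%:E)%E.
  move: x0f; rewrite /dom /=; case: (f x0) => [a _|//|_].
    by exists a.
  by exists 0; rewrite leNye.
pose d (w : 'rV[R]_n * R) := dotv (w.1 - p) (w.1 - p) + (w.2 - r0) ^+ 2.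
pose D := d (x0, s0) + 1.
have dc : continuous d.
  move=> w; apply: cvgD.
    apply: (@continuous_comp _ _ _ (fun w : 'rV[R]_n * R => w.1 - p)
      (fun x : 'rV[R]_n => dotv x x)); last exact: dotv_continuous.
    by apply: cvgB; [exact: cvg_fst|exact: cvg_cst].
  apply: (@continuous_comp _ _ _ (fun w : 'rV[R]_n * R => w.2 - r0)
    (fun a : R => a ^+ 2)); last exact: exprn_continuous.
  by apply: cvgB; [exact: cvg_snd|exact: cvg_cst].
(* The 1 in [D] makes it bound [`|a|] as soon as [D - 1] bounds [a ^+ 2]. *)
have sqr_le (a : R) : a ^+ 2 <= D - 1 -> - D <= a <= D by move=> ?; nra.
pose C := [set v : 'rV[R]_n |
    forall i, [set` `[p ord0 i - D, p ord0 i + D]] (v ord0 i)]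
  `*` [set` `[r0 - D, r0 + D]].
have Cd w : d w <= d (x0, s0) -> C w.
  move=> dw; split => [i|] /=; rewrite in_itv /=.
    have := sqr_le ((w.1 - p) ord0 i); rewrite !mxE.
    have := coord_le_dotv (w.1 - p) i; rewrite !mxE => h1 h2.
    have := sqr_ge0 (w.2 - r0) => h3.
    have /h2 : (w.1 ord0 i - p ord0 i) ^+ 2 <= D - 1.
      by move: dw; rewrite /D {1}/d; lra.
    by move=> /andP[? ?]; apply/andP; split; lra.
  have : (w.2 - r0) ^+ 2 <= D - 1.
    by have := dotv_ge0 (w.1 - p); move: dw; rewrite /D {1}/d; lra.
  by move=> /sqr_le /andP[? ?]; apply/andP; split; lra.
have Cc : compact C.
  apply: compact_setX; last exact: segment_compact.
  apply: (@rV_compact R n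
    (fun i => [set` `[p ord0 i - D, p ord0 i + D]])) => i.
  exact: segment_compact.
have [|||[z r]] := @compact_EVT_min _ R d (C `&` epigraph f).
- by exists (x0, s0); split; [exact: Cd|].
- exact: compact_closedI.
- exact: continuous_subspaceT.
rewrite inE => -[_ fz] zmin; exists z, r; split => // y s fy.
have [dy|/ltW dy] := leP (d (y, s)) (d (x0, s0)).
  by apply: (zmin (y, s)); rewrite inE; split; [exact: Cd|].
apply: le_trans dy; apply: (zmin (x0, s0)).
by rewrite inE; split; [exact: Cd|].
Qed.

Lemma epigraph_convex f y z (s r t : R) : convex_fun f -> 0 <= t <= 1 ->
  (f y <= s%:E)%E -> (f z <= r%:E)%E ->
  (f (t *: y + (1 - t) *: z)%R <= (t * s + (1 - t) * r)%:E)%E.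
Proof.
move=> fv t01 fy fz; apply: le_trans (fv _ _ _ t01) _.
case/andP: t01 => t0 t1; rewrite (EFinD (t * s)) !EFinM.
by apply: leeD; apply: lee_wpmul2l => //; rewrite lee_fin // subr_ge0.
Qed.

(** The variational inequality of the projection onto a convex set.  An
    epigraph is stable under increasing the last coordinate, so a projection
    never lowers it: this is [r0 <= r]. *)
Lemma epigraph_projection f p (r0 : R) :
  closed_fun f -> convex_fun f -> dom f !=set0 ->
  exists z r, [/\ (f z <= r%:E)%E, r0 <= r & forall y s, (f y <= s%:E)%E ->
    dotv (p - z) (y - z) + (r0 - r) * (s - r) <= 0].
Proof.
move=> fc fv f0; have [z [r [fz zmin]]] := epigraph_nearest p r0 fc f0.
have vi y s : (f y <= s%:E)%E ->
    dotv (p - z) (y - z) + (r0 - r) * (s - r) <= 0.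
  move=> fy; rewrite -oppr_ge0 -(@pmulr_rge0 _ 2) //.
  apply: (@slope_ge0 _ _ (dotv (y - z) (y - z) + (s - r) ^+ 2)).
  move=> t /andP[t0 t1].
  have t01 : 0 <= t <= 1 by rewrite (ltW t0) t1.
  have := zmin _ _ (epigraph_convex fv t01 fy fz).
  rewrite -subr_ge0; congr (_ <= _).
  rewrite !dotvE !(dotvC _ p) !(dotvC z y); ring.
exists z, r; split => //.
have := vi z (r + 1); rewrite subrr dotv0 add0r.
have -> : r + 1 - r = 1 by ring.
rewrite mulr1 subr_le0; apply.
by apply: le_trans fz _; rewrite lee_fin lerDl.
Qed.

End Epigraph.

(** * Conjugates and subgradients *)

Section Conjugate.
Context {R : realType} {n : nat}.
Implicit Types (f g phi : 'rV[R]_n -> \bar R) (x y z p u : 'rV[R]_n).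

Lemma proper_fin phi x : proper_fun phi -> (phi x < +oo)%E ->
  exists a : R, phi x = a%:E.
Proof.
case=> /(_ x) + _; case: (phi x) => [a _ _|//|//].
by exists a.
Qed.

Lemma fenchel_ge g y z (s : R) : (g z <= s%:E)%E ->
  ((dotv y z - s)%:E <= fenchel g y)%E.
Proof.
move=> gz; apply: le_trans (ereal_sup_ubound _); last by exists z.
by rewrite EFinB leeB.
Qed.

Lemma fenchel_le g y (c : R) : proper_fun g ->
  (forall z s, (g z <= s%:E)%E -> dotv y z - s <= c) ->
  (fenchel g y <= c%:E)%E.
Proof.
case=> gNy _ h; apply: ge_ereal_sup => _ [z _ <-].
move: (gNy z) (h z); case: (g z) => [s _ /(_ s)|_ _|//].
  by rewrite -EFinB lee_fin; exact.
by rewrite leNye.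
Qed.

(** The conjugate is finite at the slope of any affine minorant of [g], and
    projecting a point strictly below the graph onto the epigraph yields one. *)
Lemma fenchel_proper g : closed_fun g -> convex_fun g -> proper_fun g ->
  proper_fun (fenchel g).
Proof.
move=> gc gv gp; have [_ [x0 x0g]] := gp; split.
  move=> y; have [a gx0] := proper_fin gp x0g.
  have : ((dotv y x0 - a)%:E <= fenchel g y)%E by apply: fenchel_ge; rewrite gx0.
  by case: (fenchel g y).
have [a gx0] := proper_fin gp x0g.
have [z [r [gz r0r vi]]] :=
  epigraph_projection x0 (a - 1) gc gv (ex_intro _ x0 x0g).
(* Otherwise the separating hyperplane would be vertical; tested against
   [(x0, a)] it would make [(x0, a - 1)] its own projection. *)
have r_gt : 0 < r - (a - 1).
  rewrite lt_neqAle subr_ge0 r0r andbT; apply/eqP => /esym/eqP.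
  rewrite subr_eq0 => /eqP ra.
  have : dotv (x0 - z) (x0 - z) <= 0.
    by have := vi x0 a; rewrite gx0 ra subrr mul0r addr0; exact.
  move=> /dotv_eq0/eqP; rewrite subr_eq0 => /eqP zx0.
  by move: gz; rewrite -zx0 gx0 lee_fin ra; lra.
pose w := (r - (a - 1))^-1 *: (x0 - z).
exists w; rewrite /dom /=.
apply: (@le_lt_trans _ _ (dotv w z - r)%:E); last by rewrite ltry.
apply: fenchel_le => // y s gy; rewrite -subr_ge0 -(pmulr_rge0 _ r_gt).
have := vi y s gy; rewrite -oppr_ge0; congr (_ <= _).
rewrite /w !dotvE; field; exact: lt0r_neq0.
Qed.

(** At a point of value [+oo] the subgradient inequality would force the
    function to be [+oo] everywhere. *)
Lemma subdiff_fin phi x s : proper_fun phi -> subdiff phi x s ->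
  exists a : R, phi x = a%:E.
Proof.
move=> phip xs; apply: proper_fin => //.
have [_ [y yphi]] := phip; have [b phiy] := proper_fin phip yphi.
by have := xs y; rewrite phiy; case: (phi x) => [a _|//|_]; rewrite ?ltry.
Qed.

(** Fenchel equality on the dual side.  The inequality that is not immediate
    says that [(p, <u, p> - c)] lies in the epigraph of [g].  Project this point
    on the epigraph.  A projection that moves it upwards gives an affine
    minorant of slope [w], hence an upper bound of the conjugate at [w]; one that
    moves it horizontally along [p - z] gives an upper bound of the conjugate at
    [u + (p - z)].  Either bound contradicts the subgradient inequality
    for [p] at [u], unless the point did not move. *)
Lemma fenchel_eq_of_subdiff g u p : closed_fun g -> convex_fun g ->
  proper_fun g -> subdiff (fenchel g) u p ->
  exists c : R, fenchel g u = c%:E /\ g p = (dotv u p - c)%:E.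
Proof.
move=> gc gv gp up.
have [c gu] := subdiff_fin (fenchel_proper gc gv gp) up.
have sub w (b : R) : (fenchel g w <= b%:E)%E -> c + dotv p (w - u) <= b.
  by move=> gw; rewrite -lee_fin EFinD -gu (le_trans (up w)).
exists c; split => //; apply/eqP; rewrite eq_le; apply/andP; split; last first.
  have := gp.1 p; case gpE: (g p) => [a|//|//] _; last by rewrite leey.
  have : ((dotv u p - a)%:E <= fenchel g u)%E by apply: fenchel_ge; rewrite gpE.
  by rewrite gu !lee_fin; lra.
have [z [r [gz r0r vi]]] := epigraph_projection p (dotv u p - c) gc gv gp.2.
have usup y s : (g y <= s%:E)%E -> dotv u y - s <= c.
  by move=> gy; rewrite -lee_fin -gu; exact: fenchel_ge.
suff [zp rE] : z = p /\ r = dotv u p - c by rewrite -rE -zp.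
move: r0r; rewrite le_eqVlt => /orP[/eqP rE|r0r].
  split => //; apply/esym/eqP; rewrite -subr_eq0; apply/eqP/dotv_eq0.
  have /sub : (fenchel g (u + (p - z)) <= (c + dotv (p - z) z)%:E)%E.
    apply: fenchel_le => // y s gy; have := usup y s gy.
    by have := vi y s gy; rewrite rE !dotvE; lra.
  by rewrite !dotvE !(dotvC _ p); lra.
exfalso; pose t := r - (dotv u p - c).
have t0 : 0 < t by rewrite /t subr_gt0.
pose w := t^-1 *: (p - z).
have tw : t *: w = p - z by rewrite scalerA divff ?scale1r ?lt0r_neq0.
move: w tw => w tw.
have /sub : (fenchel g w <= (dotv w z - r)%:E)%E.
  apply: fenchel_le => // y s gy; rewrite -subr_ge0 -(pmulr_rge0 _ t0).
  have := vi y s gy; rewrite -oppr_ge0; congr (_ <= _).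
  by rewrite -tw /t !dotvE; ring.
have : 0 <= dotv w (p - z).
  by rewrite -tw dotvZr mulr_ge0 ?(ltW t0) ?dotv_ge0.
by move: t0; rewrite /t !dotvE !(dotvC _ u) !(dotvC w); lra.
Qed.

Lemma fenchel_convex g : proper_fun g -> proper_fun (fenchel g) ->
  convex_fun (fenchel g).
Proof.
move=> gp gsp x y t t01.
(* For [t] strictly between 0 and 1 an infinite value on the right-hand side
   is not annihilated by its coefficient. *)
have [->|t_n0] := eqVneq t 0.
  by rewrite subr0 scale0r add0r scale1r mul0e add0e mul1e.
have [->|t_n1] := eqVneq t 1.
  by rewrite subrr scale0r addr0 scale1r mul0e adde0 mul1e.
have t0 : 0 < t by rewrite lt_neqAle eq_sym t_n0; case/andP: t01.
have t1 : 0 < 1 - t by rewrite subr_gt0 lt_neqAle t_n1; case/andP: t01.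
have := gsp.1 x; have := gsp.1 y.
case gx: (fenchel g x) => [a|//|//]; last first.
  case gy: (fenchel g y) => [b|//|//] _ _.
    by rewrite gt0_muley ?lte_fin // addye // leey.
  by rewrite !gt0_muley ?lte_fin // addye // leey.
case gy: (fenchel g y) => [b|//|//] _ _; last first.
  by rewrite gt0_muley ?lte_fin // addey // leey.
rewrite -!EFinM -EFinD; apply: fenchel_le => // z s gz.
have ha : dotv x z - s <= a by rewrite -lee_fin -gx fenchel_ge.
have hb : dotv y z - s <= b by rewrite -lee_fin -gy fenchel_ge.
rewrite !dotvE.
have : t * (dotv x z - s) <= t * a by rewrite ler_pM2l.
have : (1 - t) * (dotv y z - s) <= (1 - t) * b by rewrite ler_pM2l.
lra.
Qed.

(** Compare the minimizer [y] with the points of the segment from [y] to [z],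
    bound [phi] there by convexity, and keep the first-order term. *)
Lemma prox_subdiff phi x y (c : R) : 0 < c -> convex_fun phi ->
  proper_fun phi -> prox (fun z => c%:E * phi z)%E x y ->
  subdiff phi y (c^-1 *: (x - y)).
Proof.
move=> c0 phiv phip pxy.
have [a phiy] : exists a : R, phi y = a%:E.
  apply: proper_fin => //; have [phiNy [x0 x0phi]] := phip.
  have [b phix0] := proper_fin phip x0phi.
  have := pxy x0; rewrite phix0; case: (phi y) (phiNy y) => [a _ _|_|//].
    by rewrite ltry.
  by rewrite gt0_muley ?lte_fin // addye // -EFinM -EFinD leye_eq.
move=> z; have := phip.1 z; case phiz: (phi z) => [b|//|//] _; last first.
  by rewrite leey.
rewrite phiy -EFinD lee_fin -subr_ge0 -(pmulr_rge0 _ c0).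
apply: (@slope_ge0 _ _ (2^-1 * dotv (z - y) (z - y))) => t /andP[t0 t1].
have t01 : 0 <= t <= 1 by rewrite ltW.
have phia : (phi y <= a%:E)%E by rewrite phiy.
have phib : (phi z <= b%:E)%E by rewrite phiz.
have /= := pxy (t *: z + (1 - t) *: y); rewrite phiy.
have le1 := epigraph_convex phiv t01 phib phia.
have /le_trans h := lee_wpmul2l (ltW (c0 : (0 < c%:E)%E)) le1.
move=> /le_trans /(_ (leeD2r _ (h _ (lexx _)))).
rewrite -!EFinM -!EFinD lee_fin !enorm_sqr -subr_ge0; congr (_ <= _).
rewrite !dotvE !(dotvC _ x) !(dotvC z y); field; exact: lt0r_neq0.
Qed.

End Conjugate.

(** * The primal-dual gap along the iteration *)

Section Telescoping.
Context {R : realType} {n : nat}.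
Context (alpha : R) (z v : nat -> 'rV[R]_n)
  (z_step : forall k, z k.+1 = z k - alpha *: v k.+1).

Lemma step_telescope K : z K = z 0%N - alpha *: \sum_(1 <= k < K.+1) v k.
Proof.
elim: K => [|K IH]; first by rewrite big_geq // scaler0 subr0.
by rewrite z_step IH (@big_nat_recr _ _ _ K.+1) //= scalerDr opprD addrA.
Qed.

(** Telescoping turns the left-hand side into [- alpha] times the sum of
    [<v k, v l>] over [l <= k], which is half of the full double sum plus half
    of its diagonal. *)
Lemma sum_dotv_displacement K :
  \sum_(1 <= k < K.+1) dotv (v k) (z k - z 0%N) =
  - (alpha / 2) * (dotv (\sum_(1 <= k < K.+1) v k) (\sum_(1 <= k < K.+1) v k)
                   + \sum_(1 <= k < K.+1) dotv (v k) (v k)).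
Proof.
elim: K => [|K IH]; first by rewrite !big_geq // dotv0; ring.
rewrite (@big_nat_recr _ _ _ K.+1) //= IH step_telescope !(@big_nat_recr _ _ _ K.+1) //=.
set V := \sum_(1 <= k < K.+1) v k.
by rewrite !dotvE (dotvC V); field.
Qed.

Lemma sum_pairwise_dist K :
  \sum_(1 <= k < K.+1) \sum_(1 <= l < k) dotv (v k - v l) (v k - v l) =
  K%:R * (\sum_(1 <= k < K.+1) dotv (v k) (v k))
  - dotv (\sum_(1 <= k < K.+1) v k) (\sum_(1 <= k < K.+1) v k).
Proof.
elim: K => [|K IH]; first by rewrite !big_geq // dotv0; ring.
rewrite (@big_nat_recr _ _ _ K.+1) //= IH !(@big_nat_recr _ _ _ K.+1) //=.
have -> : \sum_(1 <= l < K.+1) dotv (v K.+1 - v l) (v K.+1 - v l) =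
    K%:R * dotv (v K.+1) (v K.+1)
    - 2 * dotv (v K.+1) (\sum_(1 <= l < K.+1) v l)
    + \sum_(1 <= l < K.+1) dotv (v l) (v l).
  have -> : K%:R * dotv (v K.+1) (v K.+1) =
      \sum_(1 <= l < K.+1) dotv (v K.+1) (v K.+1).
    by rewrite sumr_const_nat subn1 mulr_natl.
  rewrite dotv_sumr mulr_sumr -sumrB -big_split; apply: eq_bigr => l _ /=.
  by rewrite !dotvE (dotvC (v l)); ring.
set V := \sum_(1 <= k < K.+1) v k.
by rewrite !dotvE (dotvC V) -natr1; ring.
Qed.

End Telescoping.

(** The part of the claim in which no value of [f] or [g] occurs; the
    vectors [vs k - us k] and [xs k - alpha *: vs k] are the two subgradients
    at step [k].  Expanding the square in [S1] and the distances in [S2], both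
    sides become the same combination of the inner products of the sum
    of the [vs k] with [xs 0 - x] and [us 0 - u], the square of this sum, and
    the sum of the squares. *)
Lemma averaged_gap {R : realType} {n : nat} (alpha : R)
    (xs us vs : nat -> 'rV[R]_n) (x u : 'rV[R]_n) (K : nat) :
  0 < alpha -> (0 < K)%N ->
  (forall k, xs k.+1 - alpha *: us k.+1 =
             xs k - alpha *: us k - alpha *: vs k.+1) ->
  dotv u (K%:R^-1 *: \sum_(1 <= k < K.+1) xs k)
  - dotv (K%:R^-1 *: \sum_(1 <= k < K.+1) us k) x
  - (alpha * K.+1%:R)^-1 *
      (dotv (xs 0%N - x) (xs 0%N - x)
       + alpha ^+ 2 * dotv (us 0%N - u) (us 0%N - u)) =
  K%:R^-1 * (\sum_(1 <= k < K.+1) dotv (vs k - us k) (x - xs k))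
  + K%:R^-1 * (\sum_(1 <= k < K.+1) dotv (u - us k) (xs k - alpha *: vs k))
  - (alpha * K.+1%:R)^-1 *
      (enorm (xs 0%N - x -
         (alpha * K.+1%:R / (2 * K%:R)) *: \sum_(1 <= k < K.+1) vs k) ^+ 2
       + alpha ^+ 2 *
         enorm (us 0%N - u +
           (K.+1%:R / (2 * K%:R)) *: \sum_(1 <= k < K.+1) vs k) ^+ 2)
  - alpha / (2 * K%:R ^+ 2) *
      \sum_(1 <= k < K.+1) \sum_(1 <= l < k) enorm (vs k - vs l) ^+ 2.
Proof.
move=> a0 K0 z_step.
pose z k := xs k - alpha *: us k.
have T := @sum_dotv_displacement _ _ alpha z vs z_step K.
have -> : \sum_(1 <= k < K.+1) \sum_(1 <= l < k) enorm (vs k - vs l) ^+ 2 =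
    \sum_(1 <= k < K.+1) \sum_(1 <= l < k) dotv (vs k - vs l) (vs k - vs l).
  by apply: eq_bigr => k _; apply: eq_bigr => l _; exact: enorm_sqr.
rewrite sum_pairwise_dist !enorm_sqr dotvZr dotvZl dotv_sumr dotv_suml.
(* Termwise, the difference of the two sides is
   [<vs k, z k - (x - alpha *: u)>]; the anchor [z 0] splits it. *)
have E : \sum_(1 <= k < K.+1) dotv u (xs k) - \sum_(1 <= k < K.+1) dotv (us k) x
  = \sum_(1 <= k < K.+1) dotv (vs k - us k) (x - xs k)
  + \sum_(1 <= k < K.+1) dotv (u - us k) (xs k - alpha *: vs k)
  + (\sum_(1 <= k < K.+1) dotv (vs k) (z k - z 0%N)
  + dotv (\sum_(1 <= k < K.+1) vs k) (xs 0%N - x - alpha *: (us 0%N - u))).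
  rewrite dotv_suml -sumrB -!big_split; apply: eq_bigr => k _ /=.
  by rewrite /z !dotvE (dotvC (vs k) u) (dotvC (vs k) (us k)); ring.
move: E; rewrite {}T.
set V := \sum_(1 <= k < K.+1) vs k.
move: (\sum_(1 <= k < K.+1) dotv u _) (\sum_(1 <= k < K.+1) dotv (us k) _).
move: (\sum_(1 <= k < K.+1) dotv (vs k - _) _).
move: (\sum_(1 <= k < K.+1) dotv (u - _) _) => s1 s2 s3 s4 E.
rewrite -mulrBr E !dotvE.
rewrite !(dotvC _ V) !(dotvC x (xs _)) !(dotvC u (us _)) -natr1.
field.
by rewrite nat1r !lt0r_neq0 ?ltr0n.
Qed.

(** * The equality for extended values *)

Lemma sum_nat_EFin {R : realType} (F : nat -> \bar R) (G : nat -> R) (K : nat) :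
  (forall k, F k.+1 = (G k.+1)%:E) ->
  (\sum_(1 <= k < K.+1) F k = (\sum_(1 <= k < K.+1) G k)%:E)%E.
Proof. by move=> FG; rewrite -sumEFin; apply: eq_big_nat => -[//|k] _. Qed.

Theorem proposition3p5 (R : realType) (n : nat) (f g : 'rV[R]_n -> \bar R)
    (f_closed : closed_fun f) (f_convex : convex_fun f) (f_proper : proper_fun f)
    (g_closed : closed_fun g) (g_convex : convex_fun g) (g_proper : proper_fun g)
    (saddle : exists xstar ustar : 'rV[R]_n,
       [set s + ustar | s in subdiff f xstar] 0 /\
       [set s - xstar | s in subdiff (fenchel g) ustar] 0)
    (alpha : R) (alpha_gt0 : 0 < alpha)
    (xs us : nat -> 'rV[R]_n)
    (xs_step : forall k : nat,
       prox (fun z => alpha%:E * f z)%E (xs k - alpha *: us k) (xs k.+1))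
    (us_step : forall k : nat,
       prox (fun z => (alpha^-1)%:E * fenchel g z)%E
         (us k + alpha^-1 *: (2 *: xs k.+1 - xs k)) (us k.+1)) :
  let ps (k : nat) : 'rV[R]_n :=
    xs k + (xs k - xs k.-1) + alpha *: (us k.-1 - us k) in
  let gradfs (k : nat) : 'rV[R]_n :=
    alpha^-1 *: (xs k.-1 - alpha *: us k.-1 - xs k) in
  let vs (k : nat) : 'rV[R]_n := gradfs k + us k in
  (forall k : nat, (1 <= k)%N ->
     subdiff (fenchel g) (us k) (ps k) /\ subdiff f (xs k) (gradfs k)) /\
  forall K : nat, (1 <= K)%N ->
  let xbar : 'rV[R]_n := K%:R^-1 *: \sum_(1 <= k < K.+1) xs k in
  let ubar : 'rV[R]_n := K%:R^-1 *: \sum_(1 <= k < K.+1) us k in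
  forall x u pbar p gradfbar : 'rV[R]_n,
  subdiff (fenchel g) ubar pbar ->
  subdiff (fenchel g) u p ->
  subdiff f xbar gradfbar ->
  let I_f : \bar R :=
    ((K%:R^-1)%:E * (\sum_(1 <= k < K.+1)
        (f xbar - f (xs k) + (dotv gradfbar (xs k - xbar))%:E))
     + (K%:R^-1)%:E * (\sum_(1 <= k < K.+1)
        (f (xs k) - f x + (dotv (gradfs k) (x - xs k))%:E)))%E in
  let I_g : \bar R :=
    ((K%:R^-1)%:E * (\sum_(1 <= k < K.+1)
        (g (ps k) - g pbar + (dotv (us k) (pbar - ps k))%:E))
     + (K%:R^-1)%:E * (\sum_(1 <= k < K.+1)
        (g p - g (ps k) + (dotv u (ps k - p))%:E)))%E in
  let S1 : R :=
    (alpha * K.+1%:R)^-1 *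
      (enorm (xs 0%N - x -
         (alpha * K.+1%:R / (2 * K%:R)) *: \sum_(1 <= k < K.+1) vs k) ^+ 2
       + alpha ^+ 2 *
         enorm (us 0%N - u +
           (K.+1%:R / (2 * K%:R)) *: \sum_(1 <= k < K.+1) vs k) ^+ 2) in
  let S2 : R :=
    alpha / (2 * K%:R ^+ 2) *
      \sum_(1 <= k < K.+1) \sum_(1 <= l < k) enorm (vs k - vs l) ^+ 2 in
  (lagrangian f g xbar u - lagrangian f g x ubar
   - ((alpha * K.+1%:R)^-1 *
        (enorm (xs 0%N - x) ^+ 2 + alpha ^+ 2 * enorm (us 0%N - u) ^+ 2))%:E
   = I_f + I_g - S1%:E - S2%:E)%E.
Proof.
move=> ps gradfs vs.
have gs_proper := fenchel_proper g_closed g_convex g_proper.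
have gs_convex := fenchel_convex g_proper gs_proper.
have an0 : alpha != 0 by rewrite lt0r_neq0.
have ps_sub k : subdiff (fenchel g) (us k.+1) (ps k.+1).
  have := prox_subdiff _ gs_convex gs_proper (us_step k).
  rewrite invr_gt0 invrK => /(_ alpha_gt0).
  congr (subdiff _ _ _); apply/rowP => i.
  by rewrite /ps /= !mxE; field.
have gradfs_sub k : subdiff f (xs k.+1) (gradfs k.+1).
  exact: prox_subdiff alpha_gt0 f_convex f_proper (xs_step k).
split=> [[//|k] _|K K0 xbar ubar x u pbar p gradfbar pbarP pP gradfbarP
  I_f I_g S1 S2]; first by split.
have z_step k : xs k.+1 - alpha *: us k.+1 =
    xs k - alpha *: us k - alpha *: vs k.+1.
  by apply/rowP => i; rewrite /vs /gradfs /= !mxE; field.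
have psE k : ps k.+1 = xs k.+1 - alpha *: vs k.+1.
  by apply/rowP => i; rewrite /ps /vs /gradfs /= !mxE; field.
have gradfsE k : gradfs k = vs k - us k by rewrite /vs addrK.
have [a fxbar] := subdiff_fin f_proper gradfbarP.
have [cbar [gsubar gpbar]] :=
  fenchel_eq_of_subdiff g_closed g_convex g_proper pbarP.
have [c [gsu gp]] := fenchel_eq_of_subdiff g_closed g_convex g_proper pP.
pose phi k := fine (f (xs k)).
have fxs k : f (xs k.+1) = (phi k.+1)%:E.
  by have [b fb] := subdiff_fin f_proper (gradfs_sub k); rewrite /phi fb.
pose gam k := fine (fenchel g (us k)).
have gps k : g (ps k.+1) = (dotv (us k.+1) (ps k.+1) - gam k.+1)%:E.
  have [b [gb ->]] :=
    fenchel_eq_of_subdiff g_closed g_convex g_proper (ps_sub k).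
  by rewrite /gam gb.
have Kn0 : K%:R != 0 :> R by rewrite pnatr_eq0 -lt0n.
(* By Fenchel equality [g pbar], [g p] and [g (ps k)] turn into conjugate
   values; those at the [us k] cancel between the two sums, and so do the inner
   products with [pbar], because the [us k] average to [ubar]. *)
have I_gE : I_g = (cbar - c + K%:R^-1 *
    \sum_(1 <= k < K.+1) dotv (u - us k) (xs k - alpha *: vs k))%:E.
  rewrite /I_g (@sum_nat_EFin _ _ (fun k => dotv (us k) (ps k) - gam k
    - (dotv ubar pbar - cbar) + dotv (us k) (pbar - ps k))); last first.
    by move=> k; rewrite gps gpbar -EFinB -EFinD.
  rewrite (@sum_nat_EFin _ _ (fun k => dotv u p - c
    - (dotv (us k) (ps k) - gam k) + dotv u (ps k - p))); last first.
    by move=> k; rewrite gps gp -EFinB -EFinD.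
  rewrite -!EFinM -EFinD -mulrDr -big_split /=; congr EFin.
  have -> : cbar - c = K%:R^-1 * \sum_(1 <= k < K.+1)
      (cbar - c + dotv (us k) pbar - dotv ubar pbar).
    rewrite sumrB big_split /= !sumr_const_nat subn1 /= -dotv_suml.
    have -> : dotv ubar pbar = K%:R^-1 * dotv (\sum_(1 <= k < K.+1) us k) pbar.
      exact: dotvZl.
    move: (dotv _ pbar) => t; rewrite -(mulr_natl (_ - _)) -(mulr_natl (_ * _)).
    by field.
  rewrite -mulrDr -big_split /=; congr (_ * _); apply: eq_big_nat => k.
  by case: k => [//|k] _; rewrite -psE !dotvE; ring.
have LE : lagrangian f g xbar u = (a + dotv u xbar - c)%:E.
  by rewrite /lagrangian !mem_set /dom /= ?fxbar ?gsu ?ltry.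
rewrite LE I_gE /I_f (@sum_nat_EFin _ _ (fun k => a - phi k
  + dotv gradfbar (xs k - xbar))); last first.
  by move=> k; rewrite fxs fxbar -EFinB -EFinD.
have := f_proper.1 x; rewrite /lagrangian.
(* The case [f x = +oo] comes first: both sides are [-oo]. *)
case fx: (f x) => [b|//|//] _; last first.
  have -> : x \notin dom f by rewrite notin_setE /dom /= fx ltxx.
  have -> : (\sum_(1 <= k < K.+1)
      (f (xs k) - +oo + (dotv (gradfs k) (x - xs k))%:E) = -oo)%E.
    by rewrite big_ltn // fxs.
  rewrite /= gt0_muleNy ?addeNy ?addNye //.
  by rewrite lte_fin invr_gt0 ltr0n.
rewrite !mem_set /dom /= ?fx ?gsubar ?ltry //.
rewrite (@sum_nat_EFin _ _ (fun k => phi k - b + dotv (gradfs k) (x - xs k)));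
  last by move=> k; rewrite fxs -EFinB -EFinD.
rewrite -!EFinM -!(EFinB, EFinD); congr EFin.
have gap := averaged_gap x u alpha_gt0 K0 z_step.
have avg : \sum_(1 <= k < K.+1) dotv gradfbar (xs k - xbar) = 0.
  rewrite -dotv_sumr sumrB sumr_const_nat subn1 /= /xbar -scaler_nat scalerA.
  by rewrite divff // scale1r subrr dotv0.
have I_fE : K%:R^-1 * (\sum_(1 <= k < K.+1)
      (a - phi k + dotv gradfbar (xs k - xbar)))
    + K%:R^-1 * (\sum_(1 <= k < K.+1)
      (phi k - b + dotv (gradfs k) (x - xs k)))
    = a - b + K%:R^-1 *
      (\sum_(1 <= k < K.+1) dotv (vs k - us k) (x - xs k)).
  rewrite !big_split /= avg !sumrN !sumr_const_nat subn1 /=.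
  rewrite -(mulr_natl a) -(mulr_natl b).
  under [in RHS]eq_bigr do rewrite -gradfsE.
  by field.
rewrite I_fE.
move: gap; rewrite -/xbar -/ubar -/S1 -/S2 -!enorm_sqr => /eqP.
rewrite -subr_eq0 => /eqP {}gap.
by apply: subr0_eq; rewrite -[RHS]gap; ring.
Qed.
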